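(* Let $\mathbb{F}$ be a field. A simplicial complex $X$ of dimension $d$ is $\mathbb{F}$-tight if and only if $X$ is $2$-neighbourly and $\mu_i(X;\mathbb{F})=\beta_i(X;\mathbb{F})$ for all indices $i$, $0\le i\le d$.
   Context: All simplicial complexes are finite and abstract, with the empty set as a face. $X$ is $2$-neighbourly if any two vertices of $X$ form an edge. $V(X)$ is the vertex set; for a set $A$, $X[A]=\{\alpha\in X:\alpha\subseteq A\}$ is the induced subcomplex on $A\cap V(X)$. A $d$-dimensional complex $X$ is $\mathbb{F}$-tight if it is connected and, for every induced subcomplex $Y$ of $X$ and every $0\le j\le d$, the morphism $H_j(Y;\mathbb{F})\to H_j(X;\mathbb{F})$ induced by inclusion is injective. The link of a vertex $x$ is $\mathrm{lk}_X(x)=\{\alpha\in X: x\notin\alpha,\ \alpha\sqcup\{x\}\in X\}$. $\beta_i(X;\mathbb{F})=\dim_{\mathbb{F}}H_i(X;\mathbb{F})$ (unreduced homology). Define $\widetilde\beta_i=\beta_i$ for $i\ne0$ and $\widetilde\beta_0=\beta_0-1$; in particular for the trivial complex $\emptyset$ (only face the empty set), $\widetilde\beta_0(\emptyset)=-1$ and $\widetilde\beta_i(\emptyset)=0$ for $i\neq 0$. For a simplicial complex $Z$ with $m$ vertices, the sigma-vector is $$\sigma_i(Z;\mathbb{F})=\sum_{j=0}^{m}\frac{1}{\binom{m}{j}}\sum_{A\subseteq V(Z),\,\#A=j}\widetilde\beta_i(Z[A]).$$ The mu-vector of a $d$-dimensional complex $X$ with $m$ vertices is $\mu_0(X;\mathbb{F})=1$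 and, for $1\le i\le d$, $$\mu_i(X;\mathbb{F})=\delta_{i1}+\frac1m\sum_{x\in V(X)}\sigma_{i-1}(\mathrm{lk}_X(x);\mathbb{F}),$$ where $\delta$ is the Kronecker delta. *)

(* Defs.v *)
From HB Require Import structures.
From mathcomp Require Import all_boot all_order all_algebra.

Set Implicit Arguments.
Unset Strict Implicit.
Unset Printing Implicit Defensive.

Import GRing.Theory.
Local Open Scope ring_scope.
Local Open Scope quotient_scope.

(* The quotient of a vector space [vT] by a subspace [U], as a [vectType]:    *)
(* ring_quotient supplies only the underlying additive group.                 *)
Section VectorQuotient.
Variables (K : fieldType) (vT : vectType K) (U : {vspace vT}).

Definition vquot := Quotient.quot (pred_of_vspace U).
HB.instance Definition _ := Choice.on vquot.
HB.instance Definition _ := GRing.Zmodule.on vquot.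

Definition vpi (v : vT) : vquot := \pi_(Quotient.quot (pred_of_vspace U)) v.
Definition vrepr (q : vquot) : vT := repr q.

Lemma vreprK : cancel vrepr vpi. Proof. exact: reprK. Qed.

Lemma vpi_eq (v w : vT) : (vpi v == vpi w) = (v - w \in U).
Proof. by rewrite /vpi -Quotient.idealrBE. Qed.

Lemma vpiP (v w : vT) : reflect (vpi v = vpi w) (v - w \in U).
Proof. by rewrite -vpi_eq; apply: eqP. Qed.

Lemma vpiD : {morph vpi : v w / v + w}.
Proof. by move=> v w; rewrite /vpi; apply: Quotient.pi_add. Qed.

Lemma vrepr_pi (v : vT) : vrepr (vpi v) - v \in U.
Proof. by rewrite -vpi_eq vreprK. Qed.

Definition vquot_scale (a : K) (q : vquot) : vquot := vpi (a *: vrepr q).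

Lemma vquot_scaleE a v : vquot_scale a (vpi v) = vpi (a *: v).
Proof. by apply/vpiP; rewrite -scalerBr rpredZ ?vrepr_pi. Qed.

Fact vquot_scaleA a b q :
  vquot_scale a (vquot_scale b q) = vquot_scale (a * b) q.
Proof. by rewrite -[q]vreprK !vquot_scaleE scalerA. Qed.

Fact vquot_scale1 : left_id 1 vquot_scale.
Proof. by move=> q; rewrite -[q]vreprK vquot_scaleE scale1r. Qed.

Fact vquot_scaleDr : right_distributive vquot_scale +%R.
Proof.
move=> a q r; rewrite -[q]vreprK -[r]vreprK -vpiD !vquot_scaleE.
by rewrite scalerDr vpiD.
Qed.

Fact vquot_scaleDl q : {morph vquot_scale^~ q : a b / a + b}.
Proof. by move=> a b; rewrite -[q]vreprK !vquot_scaleE scalerDl vpiD. Qed.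

HB.instance Definition _ := GRing.Zmodule_isLmodule.Build K vquot
  vquot_scaleA vquot_scale1 vquot_scaleDr vquot_scaleDl.

Lemma vpi_is_linear : linear vpi.
Proof. by move=> a v w; rewrite vpiD -vquot_scaleE. Qed.
HB.instance Definition _ := GRing.isSemilinear.Build K vT vquot _ vpi
  (GRing.semilinear_linear vpi_is_linear).

Let p : 'End(vT) := (\1 - projv U)%VF.

Let pE v : p v = v - projv U v.
Proof. by rewrite /p add_lfunE opp_lfunE id_lfunE. Qed.

Let p_repr v : p (vrepr (vpi v)) = p v.
Proof.
apply/eqP; rewrite -subr_eq0 -linearB /= pE.
by rewrite projv_id ?subrr ?vrepr_pi.
Qed.

Fact vquot_vect_iso : Vector.axiom (\dim (limg p)) vquot.
Proof.
exists (fun q => \row_i coord (vbasis (limg p)) i (p (vrepr q))).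
  move=> a q r; rewrite -[q]vreprK -[r]vreprK -linearP !p_repr.
  by apply/rowP=> i; rewrite !mxE !linearP.
exists (fun r : 'rV_(\dim (limg p)) =>
          vpi (\sum_i r 0 i *: (vbasis (limg p))`_i)) => [q|r].
  under eq_bigr => i _ do rewrite mxE.
  rewrite -coord_vbasis ?memv_img ?memvf // -[RHS]vreprK; apply/vpiP.
  by rewrite pE addrAC subrr sub0r memvN memv_proj.
apply/rowP=> i; rewrite mxE p_repr.
set v := \sum_i _; suff -> : p v = v.
  by rewrite coord_sum_free ?(basis_free (vbasisP _)).
have /memv_imgP[w _ ->] : v \in limg p.
  by apply: rpred_sum => k _; rewrite rpredZ ?vbasis_mem ?memt_nth.
by rewrite !pE raddfB /= (projv_id (memv_proj U w)) subrr subr0.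
Qed.

HB.instance Definition _ := Lmodule_hasFinDim.Build K vquot vquot_vect_iso.

End VectorQuotient.

Section Complexes.
Variable T : finType.
Implicit Types (X Y : {set {set T}}) (A a : {set T}) (x y : T).

Definition simplicial_complex X : Prop :=
  set0 \in X /\ forall a b : {set T}, a \in X -> b \subset a -> b \in X.

(* Elements of [T] need not be vertices of [X]. *)
Definition vertices X : {set T} := [set x | [set x] \in X].

(* The complex whose only face is the empty set has dimension -1. *)
Definition dimension X : int := (\max_(a in X) #|a|)%N%:Z - 1.

Definition edge X : rel T := [rel x y | [set x; y] \in X].

Definition connected X : Prop :=
  {in vertices X &, forall x y, connect (edge X) x y}.

Definition two_neighbourly X : Prop :=
  {in vertices X &, forall x y, x != y -> edge X x y}.

Definition induced X A : {set {set T}} := [set a in X | a \subset A].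

Definition link X x : {set {set T}} :=
  [set a in X | (x \notin a) && (x |: a \in X)].

End Complexes.

Section Homology.
Variables (F : fieldType) (T : finType).
Implicit Types (X Y : {set {set T}}) (a : {set T}) (j : nat).

(* All chains live in the space with basis the subsets of [T], the simplex    *)
(* [a] being oriented by the enumeration order of [T], so that the chain map  *)
(* of an inclusion of complexes is an inclusion of subspaces.                 *)
Definition chain : Type := {ffun {set T} -> F^o}.
HB.instance Definition _ := Vector.on chain.

Definition simplex a : chain := [ffun b => (b == a)%:R].

(* The homology is unreduced: the boundary of a vertex is zero. *)
Definition simplex_boundary a : chain :=
  if (#|a| <= 1)%N then 0 else
  \sum_(x in a)
     (-1) ^+ #|[set y in a | (enum_rank y < enum_rank x)%N]| *: simplex (a :\ x).

Definition boundary_fun (c : chain) : chain :=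
  \sum_(a : {set T}) c a *: simplex_boundary a.

Fact boundary_is_linear : linear boundary_fun.
Proof.
move=> k u v; rewrite /boundary_fun scaler_sumr -big_split /=.
by apply: eq_bigr => a _; rewrite !ffunE scalerDl scalerA.
Qed.
HB.instance Definition _ := GRing.isSemilinear.Build F chain chain _
  boundary_fun (GRing.semilinear_linear boundary_is_linear).

Definition boundary : 'End(chain) := linfun boundary_fun.

Definition chains X j : {vspace chain} :=
  (\sum_(a in X | #|a| == j.+1) <[simplex a]>)%VS.

Definition cycles X j : {vspace chain} := (chains X j :&: lker boundary)%VS.

Definition boundaries X j : {vspace chain} := (boundary @: chains X j.+1)%VS.

(* [boundaries X j] regarded as a subspace of the vector space [cycles X j]. *)
Definition boundary_cycles X j : {vspace subvs_of (cycles X j)} :=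
  (linfun (@vsval F chain (cycles X j)) @^-1: boundaries X j)%VS.

Definition homology X j : vectType F := vquot (boundary_cycles X j).

Definition homology_class X j (z : subvs_of (cycles X j)) : homology X j :=
  vpi (boundary_cycles X j) z.

(* [vsproj] is the identity on cycles of [Y] when [Y] is a subcomplex of [X]. *)
Definition cycle_incl Y X j (z : subvs_of (cycles Y j)) :
    subvs_of (cycles X j) :=
  vsproj (cycles X j) (vsval z).

Definition homology_incl Y X j (h : homology Y j) : homology X j :=
  homology_class (cycle_incl X (vrepr h)).

Lemma chainsS Y X j : Y \subset X -> (chains Y j <= chains X j)%VS.
Proof.
move=> sYX; apply/subv_sumP => a /andP[aY ja].
by rewrite (sumv_sup a) ?(subsetP sYX) ?ja.
Qed.

Lemma cycle_inclE Y X j (z : subvs_of (cycles Y j)) :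
  Y \subset X -> vsval (cycle_incl X z) = vsval z.
Proof.
move=> sYX; rewrite vsprojK //; apply: subvP (subvsP z).
by rewrite capvS ?chainsS.
Qed.

Lemma homology_inclE Y X j (z : subvs_of (cycles Y j)) :
  Y \subset X ->
  homology_incl X (homology_class z) = homology_class (cycle_incl X z).
Proof.
move=> sYX; apply/vpiP; rewrite -memv_preim lfunE raddfB /= !cycle_inclE //.
have := vrepr_pi (boundary_cycles Y j) z; rewrite -memv_preim lfunE raddfB /=.
by apply: subvP; rewrite limgS ?chainsS.
Qed.

Definition betti X j : nat := \dim {: homology X j}.

Definition tight X : Prop :=
  connected X /\
  forall (A : {set T}) (j : nat), (j%:Z <= dimension X)%R ->
    injective (@homology_incl (induced X A) X j).

Definition reduced_betti X j : rat := (betti X j)%:R - (j == 0%N)%:R.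

Definition sigma X i : rat :=
  let m := #|vertices X| in
  \sum_(0 <= j < m.+1) ('C(m, j)%:R)^-1 *
    \sum_(A : {set T} | (A \subset vertices X) && (#|A| == j))
       reduced_betti (induced X A) i.

Definition mu X i : rat :=
  if i is i'.+1 then
    (i == 1%N)%:R + (#|vertices X|%:R)^-1 *
      \sum_(x in vertices X) sigma (link X x) i'
  else 1.

End Homology.

(* Main.v *)
Require Import Defs.
From HB Require Import structures.
From mathcomp Require Import all_boot all_order all_algebra.
From mathcomp Require Import zify ring lra.

(* Attach the vertices of a 2-neighbourly complex X one at a time. For a vertex
   x outside A, the relative homology of (X[A + x], X[A]) is the reduced
   homology of lk(x)[A] shifted by one, so the reduced Betti number i of
   lk(x)[A] is beta_{i+1}(X[A + x]) - beta_{i+1}(X[A]) plus the dimensions of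
   the kernels of H_{i+1}(X[A]) -> H_{i+1}(X[A + x]) and of
   H_i(X[A]) -> H_i(X[A + x]); the only exception is i = 0 with A empty, and it
   is what the Kronecker delta of mu_1 compensates. Averaging over the orders of
   attachment telescopes the Betti numbers, so mu_i - beta_i is a positive
   combination of dimensions of such kernels, and vanishes exactly when all
   these maps are injective. *)

Set Implicit Arguments.
Unset Strict Implicit.
Unset Printing Implicit Defensive.

Import Order.TTheory GRing.Theory Num.Theory.
Local Open Scope ring_scope.

(** * Quotients, kernels and images of linear maps *)

Section LinearAlgebra.
Variable F : fieldType.

Lemma dim_vquot (vT : vectType F) (U : {vspace vT}) :
  (\dim {: vquot U} + \dim U)%N = \dim {: vT}.
Proof.
have /= := limg_ker_dim (linfun (vpi U)) fullv.
have -> : (fullv :&: lker (linfun (vpi U)))%VS = U.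
  apply/vspaceP => v; rewrite capfv memv_ker lfunE /=.
  by rewrite -[0 in LHS](linear0 (vpi U)) vpi_eq subr0.
suff -> : limg (linfun (vpi U)) = fullv by rewrite addnC.
apply/vspaceP => q; rewrite memvf; apply/memv_imgP.
by exists (vrepr q); rewrite ?memvf // lfunE /= vreprK.
Qed.

Lemma limg_cap_lker_comp (aT bT cT : vectType F)
    (f : 'Hom(aT, bT)) (g : 'Hom(bT, cT)) (U : {vspace aT}) :
  (f @: (U :&: lker (g \o f)) = (f @: U) :&: lker g)%VS.
Proof.
apply/vspaceP => v; rewrite memv_cap; apply/memv_imgP/andP.
  case=> u; rewrite memv_cap memv_ker comp_lfunE => /andP[uU gfu] ->.
  by rewrite memv_ker memv_img.
case=> /memv_imgP[u uU ->]; rewrite memv_ker => gfu.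
by exists u; rewrite // memv_cap uU memv_ker comp_lfunE.
Qed.

(** Replacing [u] by [- u] absorbs the sign, since subspaces are closed under opposites. *)
Lemma limg_comp_anti (aT bT cT dT : vectType F) (f : 'Hom(aT, bT))
    (g : 'Hom(bT, dT)) (f' : 'Hom(aT, cT)) (g' : 'Hom(cT, dT))
    (U : {vspace aT}) :
  (forall u, g (f u) = - g' (f' u)) -> (g @: (f @: U) = g' @: (f' @: U))%VS.
Proof.
move=> anti; apply/vspaceP => v; rewrite -!limg_comp.
apply/memv_imgP/memv_imgP => -[u uU ->]; exists (- u); rewrite ?memvN //.
  by rewrite linearN /= !comp_lfunE anti.
by rewrite linearN /= !comp_lfunE anti opprK.
Qed.

End LinearAlgebra.

(** * Induced subcomplexes, links and 2-neighbourliness *)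

Section Complexes.
Variable T : finType.
Implicit Types (X : {set {set T}}) (A B a b : {set T}) (x y : T).

Lemma vertices_induced X A : vertices (induced X A) = vertices X :&: A.
Proof. by apply/setP=> x; rewrite !inE sub1set. Qed.

Lemma induced_simplicial X A :
  simplicial_complex X -> simplicial_complex (induced X A).
Proof.
case=> X0 XS; split=> [|a b]; first by rewrite inE X0 sub0set.
rewrite !inE => /andP[aX aA] ba; rewrite (XS _ _ aX ba).
exact: subset_trans ba aA.
Qed.

Lemma link_simplicial X x :
  simplicial_complex X -> x \in vertices X -> simplicial_complex (link X x).
Proof.
case=> X0 XS; rewrite inE => xX; split=> [|a b].
  by rewrite inE X0 inE setU0.
rewrite !inE => /and3P[aX xa xaX] ba; rewrite (XS _ _ aX ba).
rewrite (contra (subsetP ba x) xa) /=.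
by apply: XS xaX _; apply: setUS.
Qed.

Lemma inducedS X A B : A \subset B -> induced X A \subset induced X B.
Proof.
by move=> AB; apply/subsetP=> a; rewrite !inE => /andP[-> /subset_trans->].
Qed.

Lemma induced_sub X A : induced X A \subset X.
Proof. by apply/subsetP=> a; rewrite inE => /andP[]. Qed.

Lemma face_sub_vertices X a :
  simplicial_complex X -> a \in X -> a \subset vertices X.
Proof.
move=> [_ XS] aX; apply/subsetP=> x xa; rewrite inE.
by apply: XS aX _; rewrite sub1set.
Qed.

Lemma induced_vertices X A :
  simplicial_complex X -> induced X (A :&: vertices X) = induced X A.
Proof.
move=> hX; apply/setP=> a; rewrite !inE subsetI.
by case: (boolP (a \in X)) => //= /(face_sub_vertices hX) ->; rewrite andbT.
Qed.

Lemma induced_id X A :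
  simplicial_complex X -> vertices X \subset A -> induced X A = X.
Proof.
move=> hX VA; apply/setP=> a; rewrite !inE.
case: (boolP (a \in X)) => //= /(face_sub_vertices hX) aV.
exact: subset_trans aV VA.
Qed.

Lemma two_neighbourly_induced X A :
  two_neighbourly X -> two_neighbourly (induced X A).
Proof.
move=> nX x y; rewrite vertices_induced !inE => /andP[xX xA] /andP[yX yA] xy.
have: edge X x y by apply: nX; rewrite ?inE.
rewrite /edge /= inE subUset !sub1set xA yA !andbT; apply.
Qed.

Lemma two_neighbourly_connected X : two_neighbourly X -> connected X.
Proof.
move=> nX x y xX yX; case: (eqVneq x y) => [->//|xy].
by apply: connect1; apply: nX.
Qed.

(** Every other vertex is adjacent to [x], so the link misses only [x]; this fixes the binomial
    weights in the sigma-vector of the link. *)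
Lemma vertices_link X x : simplicial_complex X -> two_neighbourly X ->
  x \in vertices X -> vertices (link X x) = vertices X :\ x.
Proof.
move=> hX nX xX; apply/setP=> y; rewrite !inE eq_sym.
case: (eqVneq y x) => /= [_|yx]; first by rewrite andbF.
case: (boolP ([set y] \in X)) => //= yX.
have: edge X x y by apply: nX => //; rewrite 1?inE // eq_sym.
by [].
Qed.

Lemma dimension_ge0 X :
  simplicial_complex X -> (0 <= dimension X) = (vertices X != set0).
Proof.
move=> [X0 XS]; rewrite /dimension subr_ge0 lez_nat.
apply/idP/set0Pn => [|[x]].
  case: (eq_bigmax_cond (fun a : {set T} => #|a|) (A := [in X])).
    by apply/card_gt0P; exists set0.
  move=> a aX ->; rewrite card_gt0 => /set0Pn[x xa]; exists x; rewrite inE.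
  by apply: XS aX _; rewrite sub1set.
rewrite inE => xX; rewrite -(cards1 x).
exact: (leq_bigmax_cond [set x]).
Qed.

End Complexes.

(** * Signed contractions and the augmented boundary *)

Section Chains.
Variables (F : fieldType) (T : finType).
Local Notation chain := (chain F T).
Implicit Types (X Y : {set {set T}}) (A B a b : {set T}) (x y : T).
Implicit Types (c u v : chain).

(** The comparison is strict, so [b] and [x |: b] get the same sign: the incidence sign between
    [x |: b] and its facet without [x]. *)
Definition sign x b : F :=
  (-1) ^+ #|[set y in b | (enum_rank y < enum_rank x)%N]|.

(* Signed contractions by vertices anticommute, and their sum is the boundary
   of the augmented complex; contraction by x maps the chains of X[A + x] onto
   those of lk(x)[A], with kernel the chains of X[A]. *)
Definition contr_fun x c : chain :=
  [ffun b : {set T} => if x \in b then 0 else sign x b * c (x |: b)].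

Fact contr_is_linear x : linear (contr_fun x).
Proof.
move=> k u v; apply/ffunP=> b; rewrite !ffunE; case: ifP => _.
  by rewrite scaler0 addr0.
by rewrite /GRing.scale /= mulrDr mulrCA.
Qed.
HB.instance Definition _ x := GRing.isSemilinear.Build F chain chain _
  (contr_fun x) (GRing.semilinear_linear (contr_is_linear x)).

Definition contr x : 'End(chain) := linfun (contr_fun x).

(** Agrees with [boundary] except on vertices, which go to [simplex F set0] instead of 0. *)
Definition aug_boundary : 'End(chain) := \sum_x contr x.
Local Notation D := aug_boundary.

Lemma contrE x c b :
  contr x c b = if x \in b then 0 else sign x b * c (x |: b).
Proof. by rewrite lfunE ffunE. Qed.

Lemma aug_boundaryE c : D c = \sum_x contr x c.
Proof. by rewrite /D sum_lfunE. Qed.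

Lemma signK x b : sign x b * sign x b = 1.
Proof. by rewrite -expr2 sqrr_sign. Qed.

Lemma sign_setU1 x y b : y \notin b ->
  sign x (y |: b) = (-1) ^+ (enum_rank y < enum_rank x)%N * sign x b.
Proof.
move=> yb; rewrite /sign -exprD; congr (_ ^+ _).
case: (boolP (enum_rank y < enum_rank x)%N) => yx; last first.
  apply: eq_card => z; rewrite !inE; case: (eqVneq z y) => //= ->.
  by rewrite (negPf yx) andbF.
have := cardsU1 y [set z in b | (enum_rank z < enum_rank x)%N].
rewrite !inE (negPf yb) /= => <-.
by apply: eq_card => z; rewrite !inE; case: (eqVneq z y) => //= ->.
Qed.

(** Exactly one of two distinct vertices precedes the other, so the two orders of removal differ by
    one sign; for equal vertices both sides vanish. *)
Lemma contrC x y c : contr x (contr y c) = - contr y (contr x c).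
Proof.
apply/ffunP=> b; rewrite !ffunE !contrE !inE.
case: (boolP (x \in b)) => xb; case: (boolP (y \in b)) => yb;
  rewrite ?orbT ?mulr0 ?oppr0 // !orbF.
rewrite (eq_sym y x); case: (eqVneq x y) => [_|xy]; rewrite ?mulr0 ?oppr0 //.
rewrite !sign_setU1 // setUCA.
have: enum_rank x != enum_rank y by apply: contraNneq xy => /enum_rank_inj ->.
rewrite neq_ltn => /orP[] lt; rewrite lt ltnNge (ltnW lt) /=; ring.
Qed.

(** Stated separately because in characteristic 2 anticommutation says nothing about equal
    vertices. *)
Lemma contr_contr x c : contr x (contr x c) = 0.
Proof.
apply/ffunP=> b; rewrite !contrE ffunE setU11; case: ifP => // _.
by rewrite mulr0.
Qed.

Lemma contr_aug_boundary x c : contr x (D c) = - D (contr x c).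
Proof.
rewrite !aug_boundaryE linear_sum -sumrN /=.
by apply: eq_bigr => y _; rewrite contrC.
Qed.

Lemma aug_boundaryK c : D (D c) = 0.
Proof.
rewrite !aug_boundaryE.
transitivity (\sum_x \sum_y contr x (contr y c)).
  by apply: eq_bigr => x _; rewrite linear_sum.
pose lt x y := (enum_rank x < enum_rank y)%N.
have split x : \sum_y contr x (contr y c) =
    \sum_(y | lt x y) contr x (contr y c) +
    \sum_(y | lt y x) contr x (contr y c).
  rewrite (bigID (lt x)) /=; congr (_ + _).
  rewrite [RHS]big_mkcond [LHS]big_mkcond /=; apply: eq_bigr => y _.
  rewrite /lt -leqNgt leq_eqVlt; case: eqP => //= /val_inj/enum_rank_inj ->.
  by rewrite contr_contr ltnn.
rewrite (eq_bigr _ (fun x _ => split x)) big_split /=.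
(* Swapping the sums in the second half makes each ordered pair of vertices meet its reverse, and
   anticommutation cancels the two. *)
rewrite [X in _ + X](exchange_big_dep predT) //= -big_split big1 //= => x _.
rewrite -big_split big1 //= => y _.
by rewrite contrC addNr.
Qed.

(** * Supports of chains; cycles, boundaries and Betti numbers *)

Lemma chain_expand c : c = \sum_a c a *: simplex F a.
Proof.
apply/ffunP=> b; rewrite sum_ffunE (bigD1 b) //= big1 => [|a ab].
  by rewrite !ffunE eqxx addr0 /GRing.scale /= mulr1.
by rewrite !ffunE eq_sym (negPf ab) scaler0.
Qed.

Lemma chainsP X j c :
  reflect (forall a, c a != 0 -> a \in X /\ #|a| = j.+1) (c \in chains F X j).
Proof.
apply: (iffP idP) => [/memv_sumP[v vP ->] a|cP].
  rewrite sum_ffunE; case: (boolP ((a \in X) && (#|a| == j.+1))).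
    by case/andP=> aX /eqP ja _.
  move=> aX; rewrite big1 ?eqxx // => b bX.
  have /vlineP[k ->] := vP _ bX; rewrite !ffunE.
  by case: (eqVneq a b) aX => [->|_ _]; rewrite ?bX // scaler0.
rewrite [c]chain_expand; apply: rpred_sum => a _.
case: (eqVneq (c a) 0) => [->|/cP[aX ja]]; first by rewrite scale0r mem0v.
rewrite rpredZ // /chains; apply: (subvP (sumv_sup a _ (subvv _))).
  by rewrite aX ja /=.
exact: memv_line.
Qed.

Lemma simplex_chains X j a :
  a \in X -> #|a| = j.+1 -> simplex F a \in chains F X j.
Proof.
move=> aX ja; apply/chainsP => b; rewrite ffunE; case: (eqVneq b a) => [->//|_].
by rewrite eqxx.
Qed.

Lemma boundary_simplex a : boundary F T (simplex F a) = simplex_boundary F a.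
Proof.
rewrite lfunE /= /boundary_fun (bigD1 a) //= big1 => [|b ba].
  by rewrite ffunE eqxx scale1r addr0.
by rewrite ffunE (negPf ba) scale0r.
Qed.

Lemma contr_simplex x a :
  contr x (simplex F a) =
  if x \in a then sign x a *: simplex F (a :\ x) else 0.
Proof.
apply/ffunP=> b; rewrite contrE !ffunE.
case: (boolP (x \in a)) => xa; last first.
  rewrite ffunE; case: ifP => // _.
  case: (eqVneq (x |: b) a) => [e|_]; last by rewrite mulr0.
  by case/negP: xa; rewrite -e setU11.
rewrite !ffunE; case: (boolP (x \in b)) => xb.
  by case: eqP xb => [->|_ _]; rewrite ?setD11 // scaler0.
case: (eqVneq b (a :\ x)) => [->|nb].
  rewrite setD1K // eqxx; congr (_ *: _).
  by rewrite -[in RHS](setD1K xa) sign_setU1 ?setD11 // ltnn mul1r.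
case: eqP => [ba|_]; last by rewrite mulr0 scaler0.
by case/eqP: nb; rewrite -ba setU1K.
Qed.

Lemma aug_boundary_simplex a :
  D (simplex F a) = \sum_(x in a) sign x a *: simplex F (a :\ x).
Proof.
rewrite aug_boundaryE [RHS]big_mkcond; apply: eq_bigr => x _.
exact: contr_simplex.
Qed.

Lemma boundary_aug X j c :
  c \in chains F X j.+1 -> boundary F T c = D c.
Proof.
move/chainsP=> cP; rewrite [c]chain_expand !linear_sum; apply: eq_bigr => a _.
rewrite !linearZ /=; case: (eqVneq (c a) 0) => [->|/cP[_ ja]].
  by rewrite !scale0r.
by rewrite boundary_simplex aug_boundary_simplex /simplex_boundary ja.
Qed.

Lemma boundary0 X c : c \in chains F X 0 -> boundary F T c = 0.
Proof.
move/chainsP=> cP; rewrite [c]chain_expand linear_sum big1 //= => a _.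
rewrite linearZ /=; case: (eqVneq (c a) 0) => [->|/cP[_ ja]].
  by rewrite scale0r.
by rewrite boundary_simplex /simplex_boundary ja scaler0.
Qed.

Lemma boundariesE X j : boundaries F X j = (D @: chains F X j.+1)%VS.
Proof.
apply/vspaceP=> v; apply/memv_imgP/memv_imgP => -[c cX ->]; exists c => //.
  exact: boundary_aug cX.
by rewrite (boundary_aug cX).
Qed.

Lemma cyclesS X j : cycles F X j.+1 = (chains F X j.+1 :&: lker D)%VS.
Proof.
apply/vspaceP=> c; rewrite !memv_cap !memv_ker.
by case: (boolP (c \in _)) => //= /boundary_aug ->.
Qed.

Lemma cycles0 X : cycles F X 0 = chains F X 0.
Proof.
apply/vspaceP=> c; rewrite memv_cap memv_ker.
by case: (boolP (c \in _)) => //= /boundary0 ->; rewrite eqxx.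
Qed.

Lemma boundaries_chains X j : simplicial_complex X ->
  (boundaries F X j <= chains F X j)%VS.
Proof.
move=> [_ XS]; rewrite boundariesE.
apply/subvP => _ /memv_imgP[c /chainsP cX ->].
rewrite aug_boundaryE; apply: rpred_sum => x _; apply/chainsP => b.
rewrite contrE; case: ifPn => [_|xb]; first by rewrite eqxx.
rewrite mulf_eq0 => /norP[_ /cX[bX]]; rewrite cardsU1 xb => -[jb].
by split=> //; apply: XS bX (subsetUr _ _).
Qed.

Lemma boundaries_cycles X j : simplicial_complex X ->
  (boundaries F X j <= cycles F X j)%VS.
Proof.
move=> hX; case: j => [|j]; first by rewrite cycles0 boundaries_chains.
rewrite cyclesS subv_cap boundaries_chains //= boundariesE.
apply/subvP => _ /memv_imgP[c cX ->].
by rewrite memv_ker aug_boundaryK.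
Qed.

(** The inclusion of the cycles into the chain space is injective, so the boundaries have the same
    dimension in either space. *)
Lemma betti_dim X j : simplicial_complex X ->
  (betti F X j + \dim (boundaries F X j))%N = \dim (cycles F X j).
Proof.
move=> hX; have := dim_vquot (boundary_cycles F X j).
rewrite -/(homology F X j) -/(betti F X j).
set V := cycles F X j; set i := linfun (@vsval F _ V).
have ker_i : lker i == 0%VS.
  by apply/lker0P => u v; rewrite !lfunE /=; apply: val_inj.
have im_i : limg i = V.
  apply/vspaceP=> v; apply/memv_imgP/idP => [[u _ ->]|vV].
    by rewrite lfunE /= subvsP.
  by exists (vsproj V v); rewrite ?memvf // lfunE /= vsprojK.
rewrite -[\dim {: subvs_of V}](limg_dim_eq (f := i)); last first.
  by rewrite (eqP ker_i) capv0.
rewrite im_i => <-; congr (_ + _)%N.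
rewrite -(limg_dim_eq (f := i)); last by rewrite (eqP ker_i) capv0.
congr (\dim _); apply/vspaceP=> v; apply/idP/memv_imgP => [vB|[u]].
  have vV := subvP (boundaries_cycles j hX) _ vB.
  exists (vsproj V v); last by rewrite lfunE /= vsprojK.
  by rewrite -memv_preim lfunE /= vsprojK.
by rewrite -memv_preim => uB ->.
Qed.

(** A boundary of [X] supported on [Y] is automatically a cycle of [Y], and such chains represent
    exactly the kernel of the map. *)
Lemma homology_incl_injP Y X j : Y \subset X ->
  simplicial_complex X ->
  injective (@homology_incl F T Y X j) <->
  (boundaries F X j :&: chains F Y j <= boundaries F Y j)%VS.
Proof.
move=> sYX hX; split=> [inj|sub h1 h2].
  apply/subvP => v; rewrite memv_cap => /andP[vB vC].
  have vZ : v \in cycles F Y j.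
    have := subvP (boundaries_cycles j hX) _ vB.
    by rewrite !memv_cap vC => /andP[].
  have: homology_class (vsproj (cycles F Y j) v) = homology_class 0.
    apply: inj; rewrite !homology_inclE //; apply/vpiP.
    rewrite -memv_preim lfunE raddfB /= !cycle_inclE //.
    by rewrite vsprojK // [X in v - X]raddf0 subr0.
  move/vpiP; rewrite -memv_preim subr0 lfunE /=.
  by rewrite vsprojK.
rewrite -[h1]vreprK -[h2]vreprK !homology_inclE // => /vpiP.
rewrite -memv_preim lfunE raddfB /= !cycle_inclE // => B.
apply/vpiP; rewrite -memv_preim lfunE raddfB /=.
apply: (subvP sub); rewrite memv_cap B.
by rewrite (subvP (capvSl _ (lker (boundary F T)))) // rpredB ?subvsP.
Qed.


(** * Contraction by a vertex and the chains of its link *)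

Lemma chains_cap_contr X A x j : x \notin A ->
  (chains F (induced X (x |: A)) j :&: lker (contr x))%VS =
  chains F (induced X A) j.
Proof.
move=> xA; apply/vspaceP=> c; rewrite memv_cap memv_ker.
apply/andP/chainsP => [[/chainsP cP /eqP c0] a ca|cP].
  have [] := cP _ ca; rewrite !inE => /andP[-> axA] ->; split=> //.
  have xa : x \notin a.
    apply: contra ca => xa; move/ffunP/(_ (a :\ x)): c0.
    rewrite contrE setD11 setD1K // ffunE => /eqP.
    by rewrite mulf_eq0 signr_eq0.
  apply/subsetP=> y ya; have := subsetP axA y ya; rewrite !inE.
  by case: eqP ya => [->|//]; rewrite (negPf xa).
split.
  apply/chainsP=> a /cP[]; rewrite !inE => /andP[-> aA] ->.
  by rewrite (subset_trans aA (subsetUr _ _)).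
apply/eqP/ffunP=> b; rewrite contrE ffunE; case: ifP => // _.
case: (eqVneq (c (x |: b)) 0) => [->|/cP[]]; first by rewrite mulr0.
by rewrite inE subUset sub1set (negPf xA) andbF.
Qed.

Lemma contr_chains X A x j : simplicial_complex X -> x \notin A ->
  (contr x @: chains F (induced X (x |: A)) j.+1)%VS =
  chains F (induced (link X x) A) j.
Proof.
move=> [_ XS] xA; apply/vspaceP=> e.
apply/memv_imgP/idP => [[c /chainsP cP ->]|].
  apply/chainsP => b; rewrite contrE; case: ifPn => [_|xb]; rewrite ?eqxx //.
  rewrite mulf_eq0 => /norP[_ /cP[]]; rewrite !inE cardsU1 xb add1n.
  case/andP=> xbX; rewrite subUset => /andP[_ bxA] -[->]; split=> //.
  rewrite xbX (XS _ _ xbX (subsetUr _ _)) /=.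
  apply/subsetP=> y yb; have := subsetP bxA y yb; rewrite !inE.
  by case: eqP yb => [->|//]; rewrite (negPf xb).
move/chainsP=> eP.
(* The witness is the cone over [e] with apex [x]; its sign cancels the sign of the contraction. *)
exists [ffun a : {set T} => if x \in a then sign x a * e (a :\ x) else 0].
  apply/chainsP=> a; rewrite ffunE; case: ifP => [xa|]; last by rewrite eqxx.
  rewrite mulf_eq0 => /norP[_ /eP[]]; rewrite !inE setD1K //.
  move=> /andP[/and3P[_ _ aX] aA]; rewrite [#|a|](cardsD1 x) xa => ->.
  have -> : a \subset x |: A by rewrite -(setD1K xa) setUS.
  by rewrite aX.
apply/ffunP=> b; rewrite contrE ffunE setU11; case: ifPn => xb.
  case: (eqVneq (e b) 0) => [//|/eP[]]; rewrite !inE.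
  by rewrite xb /= andbF.
by rewrite setU1K // sign_setU1 // ltnn mul1r mulrA signK mul1r.
Qed.

(* The dimension of the kernel of [H_j(Y) -> H_j(X)] when [Y] is a subcomplex. *)
Definition defect Y X j : nat :=
  (\dim (boundaries F X j :&: chains F Y j) - \dim (boundaries F Y j))%N.

Lemma boundaries_sub Y X j : simplicial_complex Y -> Y \subset X ->
  (boundaries F Y j <= boundaries F X j :&: chains F Y j)%VS.
Proof.
by move=> hY sYX; rewrite subv_cap boundaries_chains // limgS ?chainsS.
Qed.

Lemma defectE Y X j : simplicial_complex Y -> Y \subset X ->
  (defect Y X j + \dim (boundaries F Y j))%N =
  \dim (boundaries F X j :&: chains F Y j).
Proof. by move=> hY sYX; rewrite subnK // dimvS ?boundaries_sub. Qed.

Lemma defect_eq0 Y X j : simplicial_complex Y -> Y \subset X ->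
  (defect Y X j == 0%N) =
  (boundaries F X j :&: chains F Y j <= boundaries F Y j)%VS.
Proof.
move=> hY sYX; rewrite subn_eq0.
by rewrite -(geq_leqif (dimv_leqif_sup (boundaries_sub j hY sYX))).
Qed.

(** * Homology under the attachment of one vertex *)

Section AddVertex.
Variables (X : {set {set T}}) (A : {set T}) (x : T) (j : nat).
Hypotheses (hX : simplicial_complex X) (xA : x \notin A).
Local Notation X1 := (induced X (x |: A)).
Local Notation X0 := (induced X A).
Local Notation L := (induced (link X x) A).

Lemma boundaries_cap_contr i :
  (boundaries F X1 i :&: lker (contr x))%VS =
  (boundaries F X1 i :&: chains F X0 i)%VS.
Proof.
rewrite -(chains_cap_contr X i xA) capvA; congr (_ :&: _)%VS.
by apply/esym/capv_idPl; apply: boundaries_chains; apply: induced_simplicial.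
Qed.

(** Rank-nullity for [contr x], which maps these boundaries onto those of the link because it
    anticommutes with [D]. *)
Lemma dim_boundaries_add_vertex :
  \dim (boundaries F X1 j.+1) =
  (\dim (boundaries F X1 j.+1 :&: chains F X0 j.+1) +
   \dim (boundaries F L j))%N.
Proof.
rewrite -(limg_ker_dim (contr x) (boundaries F X1 j.+1)) boundaries_cap_contr.
congr (_ + \dim _)%N; rewrite !boundariesE -(contr_chains j.+1 hX xA).
exact: limg_comp_anti (contr_aug_boundary x).
Qed.

Lemma dim_cycles_add_vertex :
  (\dim (cycles F X1 j.+1) + \dim (boundaries F X1 j :&: chains F X0 j))%N =
  (\dim (chains F X0 j.+1) + \dim (chains F L j :&: lker D))%N.
Proof.
(* [P] consists of the chains whose boundary has no face through [x]. Rank-nullity on [P], once for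
   [D] and once for [contr x], counts its dimension in the two ways equated here. *)
set P := (chains F X1 j.+1 :&: lker (contr x \o D))%VS.
have PE : P = (chains F X1 j.+1 :&: lker (D \o contr x))%VS.
  apply/vspaceP=> c; rewrite !memv_cap !memv_ker !comp_lfunE.
  by rewrite contr_aug_boundary oppr_eq0.
have kerD : (P :&: lker D)%VS = cycles F X1 j.+1.
  rewrite cyclesS -capvA; congr (_ :&: _)%VS; apply/capv_idPr/subvP=> c.
  by rewrite !memv_ker comp_lfunE => /eqP->; rewrite linear0.
have kerx : (P :&: lker (contr x))%VS = chains F X0 j.+1.
  rewrite PE -(chains_cap_contr X j.+1 xA) -capvA; congr (_ :&: _)%VS.
  apply/capv_idPr/subvP=> c.
  by rewrite !memv_ker comp_lfunE => /eqP->; rewrite linear0.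
have := limg_ker_dim D P; rewrite kerD limg_cap_lker_comp -boundariesE.
rewrite boundaries_cap_contr => ->.
have imx : (contr x @: P)%VS = (chains F L j :&: lker D)%VS.
  by rewrite PE limg_cap_lker_comp (contr_chains j hX xA).
by have := limg_ker_dim (contr x) P; rewrite kerx imx => ->.
Qed.

Lemma dim_chainsS Y :
  \dim (chains F Y j.+1) =
  (\dim (cycles F Y j.+1) + \dim (boundaries F Y j))%N.
Proof. by rewrite cyclesS boundariesE limg_ker_dim. Qed.

(** A linear combination of the preceding dimension counts. As [chains F L j :&: lker D] is the
    space of reduced cycles, the last terms of the two sides differ by the reduced Betti number of
    [L]. *)
Lemma betti_add_vertex_aug :
  (betti F X1 j.+1 + defect X0 X1 j.+1 + defect X0 X1 j +
    \dim (boundaries F L j))%N =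
  (betti F X0 j.+1 + \dim (chains F L j :&: lker D))%N.
Proof.
have hX1 : simplicial_complex X1 by apply: induced_simplicial.
have hX0 : simplicial_complex X0 by apply: induced_simplicial.
have s01 : X0 \subset X1 by rewrite inducedS ?subsetUr.
have := betti_dim j.+1 hX1; have := betti_dim j.+1 hX0.
have := defectE j.+1 hX0 s01; have := defectE j hX0 s01.
have := dim_boundaries_add_vertex; have := dim_cycles_add_vertex.
have := dim_chainsS X0; lia.
Qed.

End AddVertex.

(** * Degree 0 and connectedness *)

Lemma aug_boundary_chains0 X : simplicial_complex X ->
  \dim (D @: chains F X 0) = (vertices X != set0).
Proof.
move=> hX; have D0 c b : c \in chains F X 0 -> D c b != 0 -> b = set0.
  move/chainsP=> cP; rewrite aug_boundaryE sum_ffunE => nz.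
  apply/eqP; apply: contraNT nz => /set0Pn[y yb].
  rewrite big1 // => x _; rewrite contrE; case: ifPn => // xb.
  case: (eqVneq (c (x |: b)) 0) => [->|/cP[_]]; first by rewrite mulr0.
  by rewrite cardsU1 xb (cardsD1 y) yb.
(* Chains of degree 0 live on vertices, so [D] is the augmentation: its image lies in the line of
   the empty face and fills it as soon as there is a vertex. *)
have sub : (D @: chains F X 0 <= <[simplex F set0]>)%VS.
  apply/subvP=> _ /memv_imgP[c cX ->]; apply/vlineP; exists (D c set0).
  apply/ffunP=> b; rewrite !ffunE; case: (eqVneq b set0) => [->|b0].
    by rewrite /GRing.scale /= mulr1.
  rewrite scaler0; apply/eqP; apply: contraNT b0 => /(D0 _ _ cX) ->.
  exact: eqxx.
case: eqP => [V0|/eqP/set0Pn[x]] /=.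
  apply/eqP; rewrite dimv_eq0 -subv0; apply/subvP=> _ /memv_imgP[c cX ->].
  suff -> : c = 0 by rewrite linear0 mem0v.
  apply/ffunP=> a; rewrite ffunE; apply/eqP; apply: contraT.
  case/(chainsP _ _ _ cX)=> aX /eqP/cards1P[y ay].
  by have := in_set0 y; rewrite -V0 inE -ay aX.
rewrite inE => xX; apply/eqP; rewrite eqn_leq.
rewrite (leq_trans (dimvS sub)) ?dim_vline ?leq_b1 //= lt0n dimv_eq0.
apply: contraTneq (oner_neq0 F) => D0'.
have : D (simplex F [set x]) \in (D @: chains F X 0)%VS.
  by rewrite memv_img ?simplex_chains ?cards1.
rewrite D0' memv0 aug_boundary_simplex big_set1 => /eqP/ffunP/(_ set0).
rewrite !ffunE setDv eqxx /GRing.scale /= mulr1 => /eqP.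
by rewrite signr_eq0.
Qed.

Lemma edge_boundaries X x y : simplicial_complex X -> edge X x y ->
  simplex F [set x] - simplex F [set y] \in boundaries F X 0.
Proof.
move=> hX; wlog lt_xy : x y / (enum_rank x < enum_rank y)%N => [wl|] xyX.
  case: (ltngtP (enum_rank x) (enum_rank y))
    => [lt|gt|/val_inj/enum_rank_inj->].
  - exact: wl.
  - by rewrite -opprB rpredN wl // /edge /= setUC.
  - by rewrite subrr mem0v.
have nxy : x != y by apply: contraTneq lt_xy => ->; rewrite ltnn.
(* The edge is oriented from the smaller vertex [x] to [y], so its boundary is [y] minus [x]. *)
have -> : simplex F [set x] - simplex F [set y] = - D (simplex F [set x; y]).
  rewrite aug_boundary_simplex big_setU1 ?inE //= big_set1.
  have -> : sign x [set x; y] = 1.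
    rewrite /sign (_ : [set z in _ | _] = set0) ?cards0 //.
    apply/setP=> z; rewrite !inE.
    case: (eqVneq z x) => [->|_] /=; first by rewrite ltnn.
    by case: (eqVneq z y) => [->|_] //=; rewrite ltnNge ltnW.
  have -> : sign y [set x; y] = -1.
    rewrite /sign (_ : [set z in _ | _] = [set x]) ?cards1 //.
    apply/setP=> z; rewrite !inE.
    case: (eqVneq z x) => [->|_] /=; first by rewrite lt_xy.
    by case: (eqVneq z y) => [->|_] //=; rewrite ltnn.
  rewrite setU1K ?inE // [[set x; y]]setUC setU1K ?inE 1?eq_sym //.
  by rewrite scale1r scaleN1r opprB.
rewrite memvN boundariesE memv_img // simplex_chains //.
by rewrite cards2 nxy.
Qed.

Lemma connected_vertices_boundaries X x y :
  simplicial_complex X -> connected X -> x \in vertices X -> y \in vertices X ->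
  simplex F [set x] - simplex F [set y] \in boundaries F X 0.
Proof.
move=> hX cX xX yX; have /connectP[p] := cX _ _ xX yX.
elim: p x {xX} => [|z p IHp] x /= => [_ ->|/andP[xz zp] yp].
  by rewrite subrr mem0v.
rewrite -(subrKA (simplex F [set z])) rpredD ?IHp //.
exact: edge_boundaries.
Qed.

(** A 0-chain whose coefficients sum to zero is a combination of differences between its vertices
    and a base vertex [y], and each difference bounds a path of edges. *)
Lemma connected_boundaries0 X : simplicial_complex X -> connected X ->
  (boundaries F X 0 = chains F X 0 :&: lker D)%VS.
Proof.
move=> hX cX; apply/vspaceP=> c; apply/idP/idP => [cB|].
  rewrite memv_cap (subvP (boundaries_chains 0 hX)) //=.
  move: cB; rewrite boundariesE memv_ker => /memv_imgP[e _ ->].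
  by rewrite aug_boundaryK.
rewrite memv_cap memv_ker => /andP[cC /eqP Dc].
have cE : c = \sum_(x in vertices X) c [set x] *: simplex F [set x].
  apply/ffunP=> b; rewrite sum_ffunE.
  case: (eqVneq (c b) 0) => [cb0|cb].
    rewrite cb0 big1 // => x _; rewrite !ffunE.
    by case: eqP => [<-|_]; rewrite ?cb0 ?scale0r ?scaler0.
  have [bX /eqP/cards1P[y by_]] := chainsP _ _ _ cC _ cb.
  rewrite by_ (bigD1 y) ?inE -?by_ //= big1 => [|x /andP[_ xy]].
    by rewrite !ffunE by_ eqxx addr0 /GRing.scale /= mulr1.
  rewrite !ffunE by_; case: eqP => [/set1_inj yx|]; last by rewrite scaler0.
  by rewrite yx eqxx in xy.
case: (set_0Vmem (vertices X)) => [V0|[y yX]].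
  by rewrite cE V0 big_set0 mem0v.
have c0 : \sum_(x in vertices X) c [set x] = 0.
  transitivity (D c set0); last by rewrite Dc ffunE.
  rewrite aug_boundaryE sum_ffunE big_mkcond; apply: eq_bigr => x _.
  rewrite contrE in_set0 setU0.
  have -> : sign x set0 = 1.
    rewrite /sign (_ : [set z in _ | _] = set0) ?cards0 //.
    by apply/setP=> z; rewrite !inE.
  rewrite mul1r; case: ifPn => // xX; case: (eqVneq (c [set x]) 0) => [//|].
  by case/(chainsP _ _ _ cC); move: xX; rewrite inE => /negPf->.
have -> : c = \sum_(x in vertices X)
    c [set x] *: (simplex F [set x] - simplex F [set y]).
  under eq_bigr do rewrite scalerBr.
  by rewrite sumrB -cE -scaler_suml c0 scale0r subr0.
by apply: rpred_sum => x xX; rewrite rpredZ ?connected_vertices_boundaries.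
Qed.

Lemma betti0_connected X : simplicial_complex X -> connected X ->
  betti F X 0 = (vertices X != set0).
Proof.
move=> hX cX; apply/eqP; rewrite -(eqn_add2r (\dim (boundaries F X 0))).
rewrite betti_dim // cycles0 connected_boundaries0 //.
by rewrite -aug_boundary_chains0 // addnC limg_ker_dim.
Qed.

(** Every boundary has augmentation zero, which suffices to bound in the connected [Y]. Tightness in
    degree 0 thus follows from connected induced subcomplexes. *)
Lemma boundaries0_cap_chains Y X : simplicial_complex X -> simplicial_complex Y ->
  connected Y -> (boundaries F X 0 :&: chains F Y 0 <= boundaries F Y 0)%VS.
Proof.
move=> hX hY cY; rewrite (connected_boundaries0 hY cY) capvC capvS //.
rewrite boundariesE; apply/subvP=> _ /memv_imgP[c _ ->].
by rewrite memv_ker aug_boundaryK.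
Qed.

Lemma betti_add_vertex X A x j : simplicial_complex X -> x \notin A ->
  x \in vertices X ->
  let X0 := induced X A in let X1 := induced X (x |: A) in
  let L := induced (link X x) A in
  (betti F X1 j.+1 + defect X0 X1 j.+1 + defect X0 X1 j +
    (if j == 0 then vertices L != set0 else false))%N =
  (betti F X0 j.+1 + betti F L j)%N.
Proof.
move=> hX xA xX X0 X1 L.
have hL : simplicial_complex L.
  by apply: induced_simplicial; apply: link_simplicial.
have := betti_add_vertex_aug j hX xA; rewrite -/X0 -/X1 -/L.
(* In degree 0 all chains are cycles for [betti], not only those in [lker D]; the difference is the
   rank of the augmentation. *)
have := betti_dim j hL; case: j => [|j] /=; last by rewrite cyclesS; lia.
rewrite cycles0 -aug_boundary_chains0 //.
have: (\dim (chains F L 0 :&: lker D) + \dim (D @: chains F L 0))%N =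
  \dim (chains F L 0) := limg_ker_dim _ _.
lia.
Qed.

(** If [x] and [y] span no edge, their difference bounds in the connected [X] but not in the
    subcomplex induced on the two of them, which has no 1-chains. *)
Lemma tight_two_neighbourly X : simplicial_complex X -> tight F X ->
  two_neighbourly X.
Proof.
move=> hX [cX inj] x y xX yX xy; apply: contraT => xyX.
have d0 : 0%:Z <= dimension X.
  by rewrite dimension_ge0 //; apply/set0Pn; exists x.
set Y := induced X [set x; y].
have hY : simplicial_complex Y by apply: induced_simplicial.
have /(homology_incl_injP _ (induced_sub X _) hX) sub := inj [set x; y] 0 d0.
have: simplex F [set x] - simplex F [set y] \in boundaries F Y 0.
  apply: (subvP sub); rewrite memv_cap connected_vertices_boundaries //=.
  rewrite rpredB // simplex_chains ?cards1 // !inE sub1set !inE eqxx ?orbT.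
    by rewrite andbT; move: xX; rewrite inE.
  by rewrite andbT; move: yX; rewrite inE.
rewrite boundariesE => /memv_imgP[c /chainsP cP].
have -> : c = 0.
  apply/ffunP=> a; rewrite ffunE; apply/eqP; apply: contraT => /cP[].
  rewrite inE => /andP[aX axy] a2; case/negP: xyX; rewrite /edge /=.
  rewrite -(_ : a = [set x; y]) //; apply/eqP.
  by rewrite eqEcard axy a2 cards2 xy.
rewrite linear0 => /ffunP/(_ [set x]); rewrite !ffunE eqxx.
case: eqP => [/set1_inj yx|_]; first by rewrite yx eqxx in xy.
by move/eqP; rewrite subr0 oner_eq0.
Qed.

End Chains.

(** * Averages over the orders of attachment *)

Section WeightedSums.
Variable T : finType.
Implicit Types (V A B : {set T}) (x : T).

Lemma sum_insert (R : zmodType) V (f : T -> {set T} -> R) :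
  \sum_(x in V) \sum_(A : {set T} | A \subset V :\ x) f x (x |: A) =
  \sum_(B : {set T} | B \subset V) \sum_(x in B) f x B.
Proof.
rewrite [RHS](exchange_big_dep [in V]) /= => [|B x /subsetP BV /BV //].
apply: eq_bigr => x xV.
rewrite [RHS](reindex_onto (fun A => x |: A) (fun B => B :\ x)) /=; last first.
  by move=> B /andP[_ xB]; rewrite setD1K.
apply: eq_bigl => A; rewrite setU11 andbT subUset sub1set xV /=.
apply/idP/andP => [AVx|[AV /eqP e]].
  have xA : x \notin A by apply/negP=> /(subsetP AVx); rewrite !inE eqxx.
  by rewrite setU1K // eqxx (subset_trans AVx (subsetDl _ _)).
rewrite -e subsetD1 setD11 andbT (subset_trans (subsetDl _ _)) //.
by rewrite subUset sub1set xV.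
Qed.

Lemma sum_avoid (R : zmodType) V (f : T -> {set T} -> R) :
  \sum_(x in V) \sum_(A : {set T} | A \subset V :\ x) f x A =
  \sum_(A : {set T} | A \subset V) \sum_(x in V :\: A) f x A.
Proof.
rewrite [RHS](exchange_big_dep [in V]) /= => [|A x _ /setDP[] //].
apply: eq_bigr => x xV; apply: eq_bigl => A.
by rewrite subsetD1 !inE xV andbT.
Qed.

(* Averaging over the orderings of [V] the telescoping sum of the increments of
   [g] along the chain of initial segments. *)
Lemma sum_increments V (g : {set T} -> rat) :
  \sum_(x in V) \sum_(A : {set T} | A \subset V :\ x)
     ('C(#|V|.-1, #|A|)%:R)^-1 * (g (x |: A) - g A) =
  #|V|%:R * (g V - g set0).
Proof.
case: (eqVneq V set0) => [->|V0].
  by rewrite big_set0 subrr mulr0.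
have m0 : (0 < #|V|)%N by rewrite card_gt0.
(* [w B] is the total weight of [g B] both as an end of increments, [#|B|] times over, and as a
   start, [m - #|B|] times over. The two cancel except that the empty set is never an end and [V]
   never a start. *)
set m := #|V|; pose w B : rat := m%:R * ('C(m, #|B|)%:R)^-1.
have -> : \sum_(x in V) \sum_(A : {set T} | A \subset V :\ x)
     ('C(m.-1, #|A|)%:R)^-1 * (g (x |: A) - g A) =
   \sum_(B : {set T} | B \subset V) \sum_(x in B)
      ('C(m.-1, #|B|.-1)%:R)^-1 * g B -
   \sum_(B : {set T} | B \subset V) \sum_(x in V :\: B)
      ('C(m.-1, #|B|)%:R)^-1 * g B.
  rewrite -sum_insert -sum_avoid -sumrB; apply: eq_bigr => x xV.
  rewrite -sumrB; apply: eq_bigr => A; rewrite subsetD1 => /andP[_ xA].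
  by rewrite cardsU1 xA mulrBr.
have -> : \sum_(B : {set T} | B \subset V) \sum_(x in B)
      ('C(m.-1, #|B|.-1)%:R)^-1 * g B =
    \sum_(B : {set T} | B \subset V) w B * g B - g set0 * m%:R.
  rewrite (bigD1 set0) ?sub0set //= [in RHS](bigD1 set0) ?sub0set //=.
  rewrite big_set0 add0r /w cards0 bin0 invr1 mulr1 mulrC addrAC subrr add0r.
  apply: eq_bigr => B /andP[BV B0].
  rewrite sumr_const -mulrnAl -mulr_natl; congr (_ * _).
  have k0 : (0 < #|B|)%N by rewrite card_gt0.
  have km : (#|B| <= m)%N by rewrite subset_leq_card.
  have := mul_bin_diag m #|B|.-1; rewrite !prednK // => e.
  have c0 : ('C(m, #|B|)%:R : rat) != 0 by rewrite pnatr_eq0 -lt0n bin_gt0.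
  have c1 : ('C(m.-1, #|B|.-1)%:R : rat) != 0.
    by rewrite pnatr_eq0 -lt0n bin_gt0 -ltnS !prednK.
  by apply/eqP; rewrite eqr_div // -!natrM e.
have -> : \sum_(B : {set T} | B \subset V) \sum_(x in V :\: B)
      ('C(m.-1, #|B|)%:R)^-1 * g B =
    \sum_(B : {set T} | B \subset V) w B * g B - g V * m%:R.
  rewrite (bigD1 V) //= [in RHS](bigD1 V) //=.
  rewrite setDv big_set0 add0r /w binn invr1 mulr1 mulrC addrAC subrr add0r.
  apply: eq_bigr => B /andP[BV nBV].
  have km : (#|B| < m)%N by rewrite proper_card // properEneq nBV.
  rewrite sumr_const -mulrnAl -mulr_natl cardsDS //; congr (_ * _).
  have e := mul_bin_down m #|B|.
  have c0 : ('C(m, #|B|)%:R : rat) != 0.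
    by rewrite pnatr_eq0 -lt0n bin_gt0 ltnW.
  have c1 : ('C(m.-1, #|B|)%:R : rat) != 0.
    by rewrite pnatr_eq0 -lt0n bin_gt0 -ltnS prednK.
  by apply/eqP; rewrite eqr_div // -!natrM e.
ring.
Qed.

End WeightedSums.

(** * The mu-vector as Betti numbers plus weighted defects *)

Section MuVector.
Variables (F : fieldType) (T : finType) (X : {set {set T}}).
Hypotheses (hX : simplicial_complex X) (nX : two_neighbourly X).
Local Notation V := (vertices X).

Lemma sigma_subsets (Z : {set {set T}}) i :
  sigma F Z i = \sum_(A : {set T} | A \subset vertices Z)
    ('C(#|vertices Z|, #|A|)%:R)^-1 * reduced_betti F (induced Z A) i.
Proof.
rewrite /sigma /=; set m := #|vertices Z|.
under eq_bigr do rewrite mulr_sumr.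
rewrite big_mkord.
rewrite (exchange_big_dep (fun A : {set T} => A \subset vertices Z)) /=;
  last by move=> j A _ /andP[].
apply: eq_bigr => A AZ.
have lt : (#|A| < m.+1)%N by rewrite ltnS subset_leq_card.
rewrite (big_pred1 (Ordinal lt)) //= => j.
by rewrite AZ /= eq_sym.
Qed.

Lemma mu_betti j : V != set0 ->
  mu F X j.+1 = (betti F X j.+1)%:R + (#|V|%:R)^-1 *
    \sum_(x in V) \sum_(A : {set T} | A \subset V :\ x)
      ('C(#|V|.-1, #|A|)%:R)^-1 *
      (defect F (induced X A) (induced X (x |: A)) j.+1 +
       defect F (induced X A) (induced X (x |: A)) j)%:R.
Proof.
move=> V0; have m0 : (#|V|%:R : rat) != 0 by rewrite pnatr_eq0 cards_eq0.
pose g A : rat := (betti F (induced X A) j.+1)%:R.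
(* The only face is the empty set, too small for a chain of degree [j.+1]. *)
have g0 : g set0 = 0.
  rewrite /g; apply/eqP; rewrite pnatr_eq0 -leqn0.
  have hI := induced_simplicial set0 hX.
  set b := \dim (boundaries F (induced X set0) j.+1).
  rewrite (leq_trans (leq_addr b _)) //.
  rewrite betti_dim // leqn0 dimv_eq0 -subv0; apply/subvP=> c.
  rewrite memv_cap memv0 => /andP[/chainsP cP _]; apply/eqP/ffunP=> a.
  rewrite ffunE; apply/eqP; apply: contraT => /cP[].
  by rewrite inE subset0 => /andP[_ /eqP->]; rewrite cards0.
have gV : g V = (betti F X j.+1)%:R by rewrite /g induced_id.
(* For [j] zero and [A] empty the induced link has no vertex: its reduced Betti number is -1, but
   the attachment identity has no correction. The last term makes up for this. *)
have step x (A : {set T}) : x \in V -> A \subset V :\ x ->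
    reduced_betti F (induced (link X x) A) j =
    (g (x |: A) - g A) +
    (defect F (induced X A) (induced X (x |: A)) j.+1 +
       defect F (induced X A) (induced X (x |: A)) j)%:R -
    ((j == 0%N) && (A == set0))%:R.
  move=> xV AVx; have xA : x \notin A.
    by apply/negP=> /(subsetP AVx); rewrite !inE eqxx.
  have := betti_add_vertex F j hX xA xV => /=.
  rewrite vertices_induced vertices_link // (setIidPr AVx).
  move/(congr1 (fun n : nat => n%:R : rat)); rewrite !natrD /reduced_betti /g.
  by case: (j == 0%N); case: (A == set0) => /= e; lra.
have sum_sigma : \sum_(x in V) sigma F (link X x) j =
    \sum_(x in V) \sum_(A : {set T} | A \subset V :\ x)
      ('C(#|V|.-1, #|A|)%:R)^-1 * (g (x |: A) - g A) +
    \sum_(x in V) \sum_(A : {set T} | A \subset V :\ x)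
      ('C(#|V|.-1, #|A|)%:R)^-1 *
      (defect F (induced X A) (induced X (x |: A)) j.+1 +
       defect F (induced X A) (induced X (x |: A)) j)%:R -
    #|V|%:R * (j == 0%N)%:R.
  rewrite mulr_natl -sumr_const -big_split -sumrB; apply: eq_bigr => x xV.
  have cV : #|V :\ x| = #|V|.-1 by rewrite [in RHS](cardsD1 x) xV.
  rewrite sigma_subsets vertices_link // cV.
  (* The empty set has weight 1, so the exceptional term costs 1 per vertex; divided by [#|V|], it
     cancels the Kronecker delta. *)
  rewrite -big_split /= (bigD1 set0) ?sub0set //=.
  rewrite [in RHS](bigD1 set0) ?sub0set //=.
  rewrite step ?sub0set // eqxx andbT cards0 bin0 invr1 !mul1r.
  rewrite [RHS]addrAC; congr (_ + _); apply: eq_bigr => A /andP[AVx A0].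
  by rewrite step // (negPf A0) andbF subr0 mulrDr.
rewrite /mu sum_sigma sum_increments g0 gV eqSS; field.
by [].
Qed.

End MuVector.

(** * Tightness in terms of defects *)

Section Tightness.
Variables (F : fieldType) (T : finType) (X : {set {set T}}).
Hypotheses (hX : simplicial_complex X).
Local Notation V := (vertices X).

(** A boundary of the larger induced subcomplex also bounds in [X], so injectivity into [X] forces
    injectivity of the one-vertex step. *)
Lemma tight_defect (A : {set T}) x j : tight F X -> j%:Z <= dimension X ->
  defect F (induced X A) (induced X (x |: A)) j = 0%N.
Proof.
case=> _ inj jd; have hA := induced_simplicial A hX.
apply/eqP; rewrite defect_eq0 ?inducedS ?subsetUr //.
have /(homology_incl_injP F _ (induced_sub X A) hX) := inj A j jd.
apply: subv_trans; rewrite capvS //.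
by rewrite !boundariesE limgS ?chainsS ?induced_sub.
Qed.

(** The map to [X] factors through the attachment of the missing vertices one at a time, and each
    factor is injective; the induction is on the number of missing vertices. *)
Lemma homology_incl_inj_defect j :
  (forall x (A : {set T}), x \in V -> A \subset V :\ x ->
     defect F (induced X A) (induced X (x |: A)) j = 0%N) ->
  forall A : {set T}, injective (@homology_incl F T (induced X A) X j).
Proof.
move=> def A; apply/(homology_incl_injP F _ (induced_sub X A) hX).
rewrite -(induced_vertices A hX); move: (subsetIr A V).
have [n] := ubnP #|V :\: (A :&: V)|; elim: n (A :&: V) => // n IHn B.
rewrite ltnS => ltn BV; case: (set_0Vmem (V :\: B)) => [VB|[x]].
  by rewrite induced_id ?capvSl // -setD_eq0 VB.
rewrite inE => /andP[xB xV]; have hB := induced_simplicial B hX.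
have BVx : B \subset V :\ x by rewrite subsetD1 BV.
have sB : induced X B \subset induced X (x |: B) by rewrite inducedS ?subsetUr.
have /eqP := def x B xV BVx; rewrite defect_eq0 //; apply: subv_trans.
rewrite subv_cap capvSr andbT; apply: subv_trans (IHn (x |: B) _ _).
- by rewrite capvS ?chainsS.
- rewrite setUC -setDDl; apply: leq_trans ltn.
  by rewrite [X in (_ < X)%N](cardsD1 x) in_setD xB xV.
- by rewrite subUset sub1set xV.
Qed.

End Tightness.

Theorem proposition4p16 (F : fieldType) (T : finType) (X : {set {set T}})
    (d : int) (hX : simplicial_complex X) (hd : dimension X = d) :
  tight F X <->
  two_neighbourly X /\
  (forall i : nat, i%:Z <= d -> mu F X i = (betti F X i)%:R).
Proof.
have V0 (i : nat) : i%:Z <= d -> vertices X != set0.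
  by rewrite -hd -dimension_ge0 //; apply: le_trans.
split=> [tX|[nX muX]].
  have nX := tight_two_neighbourly hX tX; split=> // -[|i] id.
    have [cX _] := tX; rewrite betti0_connected // (V0 0%N id) //.
  rewrite mu_betti ?(V0 _ id) //.
  rewrite big1 ?mulr0 ?addr0 // => x _; rewrite big1 // => A _.
  rewrite !tight_defect ?mulr0 ?hd //.
  by apply: le_trans id; rewrite lez_nat.
split=> [|A j]; first exact: two_neighbourly_connected.
(* Degree 0 is separate, [mu F X 0] being 1 by convention: 2-neighbourliness passes to induced
   subcomplexes and makes them connected. *)
rewrite hd; case: j => [_|j jd].
  apply/(homology_incl_injP F _ (induced_sub X A) hX).
  apply: boundaries0_cap_chains => //; first exact: induced_simplicial.
  exact/two_neighbourly_connected/two_neighbourly_induced.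
apply: homology_incl_inj_defect => // x B xV BVx.
(* Cancelling the Betti number leaves a vanishing sum of nonnegative terms, so every term is
   zero. *)
have := muX _ jd; rewrite mu_betti ?(V0 _ jd) // -[RHS]addr0 => /addrI/eqP.
have m0 : (#|vertices X|%:R : rat) != 0.
  by rewrite pnatr_eq0 cards_eq0 (V0 _ jd).
rewrite mulf_eq0 invr_eq0 (negPf m0) /=.
rewrite psumr_eq0 => [|y _]; last first.
  by apply: sumr_ge0 => C _; rewrite mulr_ge0 ?invr_ge0 ?ler0n.
move/allP/(_ x (mem_index_enum _)); rewrite xV /=.
rewrite psumr_eq0 => [|C _]; last by rewrite mulr_ge0 ?invr_ge0 ?ler0n.
move/allP/(_ B (mem_index_enum _)); rewrite BVx /=.
(* The binomial weight is nonzero because [B] has at most [#|V|.-1] elements, so the sum of the two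
   defects vanishes. *)
rewrite mulf_eq0 invr_eq0 !pnatr_eq0 -[_ == 0%N :> nat]negbK -lt0n bin_gt0.
rewrite (leq_trans (subset_leq_card BVx)) /=.
  by rewrite addn_eq0 => /andP[/eqP].
by rewrite (cardsD1 x (vertices X)) xV.
Qed.
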